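(* For every $\epsilon>0$ there is a constant $C_\epsilon<\infty$ such that the following holds. Let $\mathcal U$ be any collection of dyadic rectangles in the plane $\mathbb R^2$ whose shadow $\operatorname{sh}(\mathcal U)$ has finite measure, and let $\mathcal U'\subset\mathcal U$ be any subcollection consisting of rectangles which are maximal. Then $$\sum_{R\in\mathcal U'}\operatorname{emb}(R,\mathcal U')^{-\epsilon}\,|R|\le C_\epsilon\,|\operatorname{sh}(\mathcal U')|.$$
   Context: The dyadic intervals are $\mathcal D=\{[j2^k,(j+1)2^k): j,k\in\mathbb Z\}$. A dyadic rectangle in the plane is a product $R=R_{(1)}\times R_{(2)}$ with $R_{(1)},R_{(2)}\in\mathcal D$. The shadow of a collection $\mathcal U$ of dyadic rectangles is $\operatorname{sh}(\mathcal U)=\bigcup_{R\in\mathcal U}R$. Maximal elements of a collection $\mathcal U$ are those rectangles of $\mathcal U$ that are maximal with respect to inclusion among the members of $\mathcal U$. $|A|$ denotes Lebesgue measure. The strong maximal function is $\operatorname M f(x)=\sup_{R\ni x}|R|^{-1}\int_R|f(y)|\,dy$, the supremum being over all (not necessarily dyadic) rectangles $R$ with sides parallel to the coordinate axes that contain $x$. For a collection $\mathcal U$ of dyadic rectangles, set $$\operatorname{Enl}_2(\mathcal U)=\{x\in\mathbb R^2:\operatorname M\mathbf 1_{\operatorname{sh}(\mathcal U)}(x)>\tfrac1{16}\}.$$ For an interval $I$ and $\lambda>0$, $\lambda I$ is the interval with the same center as $I$ and length $\lambda|I|$. For $\mu_1,\mu_2>0$, $\operatorname{Dil}_{(\mu_1,\mu_2)}R=(\mu_1R_{(1)})\times(\mu_2R_{(2)})$.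 For a collection $\mathcal U$ and $R\in\mathcal U$, the embeddedness of $R$ is $$\operatorname{emb}(R,\mathcal U)=\sup\{\mu_1\mu_2:\ \operatorname{Dil}_{(\mu_1,\mu_2)}R\subset\operatorname{Enl}_2(\mathcal U),\ \mu_1\ge1,\ \mu_2\ge1\}.$$ In the claim this definition is applied to the collection $\mathcal U'$. *)

(* Defs.v *)
From HB Require Import structures.
From mathcomp Require Import all_boot all_order all_algebra.
From mathcomp Require Import all_classical all_reals all_analysis.
From mathcomp Require Import ring.
Set Implicit Arguments.
Unset Strict Implicit.
Unset Printing Implicit Defensive.
Import Order.TTheory GRing.Theory Num.Theory.
Import numFieldNormedType.Exports.
Local Open Scope classical_set_scope.
Local Open Scope ring_scope.

(** Dyadic intervals are coded by pairs of integers, [(j, k)] standing for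
    [[j 2^k, (j+1) 2^k[], and dyadic rectangles by pairs of such codes.  The
    coding is injective ([dyadic_interval_inj], [rect_inj] below), so
    collections of dyadic rectangles are the same thing as sets of codes. *)
Definition dyadic := (int * int)%type.
Definition dyadic_rect := (dyadic * dyadic)%type.

Section defs.
Variable R : realType.
Implicit Types (I : dyadic) (Q : dyadic_rect) (U : set dyadic_rect).

Definition dyadic_interval I : set R :=
  [set` `[I.1%:~R * 2 ^ I.2, (I.1 + 1)%:~R * 2 ^ I.2[].

Definition rect Q : set (R * R) := dyadic_interval Q.1 `*` dyadic_interval Q.2.

Definition shadow U : set (R * R) := \bigcup_(Q in U) rect Q.

Definition is_maximal U Q : Prop :=
  U Q /\ forall Q', U Q' -> rect Q `<=` rect Q' -> rect Q' = rect Q.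

Definition area : set (R * R) -> \bar R :=
  (lebesgue_measure \x lebesgue_measure)%E.

(** Axis-parallel rectangles with positive and finite area; their sides may be
    open, closed or half-open. *)
Definition axis_rect : set (set (R * R)) :=
  [set A | exists i j : interval R, A = [set` i] `*` [set` j] /\
    (0 < area A < +oo)%E].

Definition strong_maximal (f : R * R -> R) (x : R * R) : \bar R :=
  ereal_sup [set ((area A)^-1 *
                  \int[lebesgue_measure \x lebesgue_measure]_(y in A)
                    `|f y|%:E)%E | A in [set A | axis_rect A /\ A x]].

Definition enl2 U : set (R * R) :=
  [set x | (16^-1%R%:E < strong_maximal \1_(shadow U) x)%E].

(** [dilate_interval l I] has the centre of [dyadic_interval I] and [l] times
    its length; like the latter, it is closed on the left and open on the
    right. *)
Definition dilate_interval (l : R) I : set R :=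
  let c := (I.1%:~R + 2^-1) * 2 ^ I.2 in
  let h := l * 2 ^ I.2 / 2 in
  [set` `[c - h, c + h[].

Definition dil (m : R * R) Q : set (R * R) :=
  dilate_interval m.1 Q.1 `*` dilate_interval m.2 Q.2.

(** The supremum is taken in [\bar R].  Its power of exponent [- e] with [0 < e]
    has to be written [(emb Q U `^ e)^-1], which vanishes at [+oo]: [poweR]
    sends [+oo] to [+oo] for every nonzero exponent, even a negative one. *)
Definition emb Q U : \bar R :=
  ereal_sup [set (m.1 * m.2)%:E | m in
    [set m : R * R | [/\ dil m Q `<=` enl2 U, 1 <= m.1 & 1 <= m.2]]].

Lemma dil1 Q : dil (1, 1) Q = rect Q.
Proof.
have dilate1 I : dilate_interval 1 I = dyadic_interval I.
  rewrite /dilate_interval /dyadic_interval /= intrD.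
  set a := _ - _; set b := _ + _.
  have -> : a = I.1%:~R * 2 ^ I.2 by rewrite /a; field.
  by have -> : b = (I.1%:~R + 1) * 2 ^ I.2 by rewrite /b; field.
by rewrite /dil !dilate1.
Qed.

Lemma dyadic_interval_inj : injective dyadic_interval.
Proof.
move=> [j k] [j' k'] E.
have lt (j0 k0 : int) : (j0%:~R * 2 ^ k0 : R) < (j0 + 1)%:~R * 2 ^ k0.
  by rewrite ltr_pM2r ?exprz_gt0// ltr_int ltzD1.
have lo := congr1 inf E; have hi := congr1 sup E; move: lo hi.
rewrite /dyadic_interval/= !inf_itv ?bnd_simp//= !sup_itv ?bnd_simp//= => lo.
rewrite !intrD !mulrDl lo => /addrI; rewrite !mul1r => e.
have ek : k = k' by apply: ieexprIz e; rewrite // eq_sym lt_eqF// ltr1n.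
move: lo; rewrite ek => /mulIf e'; congr pair.
by apply/eqP; rewrite -(eqr_int R); apply/eqP/e'; rewrite expfz_neq0.
Qed.

Lemma rect_inj : injective rect.
Proof.
have ne I : dyadic_interval I !=set0.
  exists (I.1%:~R * 2 ^ I.2); rewrite /dyadic_interval/= in_itv/= lexx/=.
  by rewrite ltr_pM2r ?exprz_gt0// ltr_int ltzD1.
have sub P Q : rect P = rect Q ->
    dyadic_interval P.1 `<=` dyadic_interval Q.1 /\
    dyadic_interval P.2 `<=` dyadic_interval Q.2.
  move=> E; have [a Pa] := ne P.1; have [b Pb] := ne P.2.
  split=> [x Px|x Px].
    by have : rect P (x, b) by []; rewrite E => -[].
  by have : rect P (a, x) by []; rewrite E => -[].
move=> [P1 P2] [Q1 Q2] E.
have [/= s1 s2] := sub _ _ E; have [/= t1 t2] := sub _ _ (esym E).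
by congr pair; apply: dyadic_interval_inj; apply/seteqP; split.
Qed.

End defs.

Arguments dyadic_interval R I : clear implicits.
Arguments rect R Q : clear implicits.
Arguments shadow R U : clear implicits.
Arguments is_maximal R U Q : clear implicits.
Arguments emb R Q U : clear implicits.

(* Main.v *)
Require Import Defs.
From mathcomp Require Import all_boot all_order all_algebra.
From mathcomp Require Import all_classical all_reals all_analysis.
From mathcomp Require Import ring lra.
Import Order.TTheory GRing.Theory Num.Theory.
Import numFieldNormedType.Exports.
Local Open Scope classical_set_scope.
Local Open Scope ring_scope.

(** The embeddedness is bounded below by dilating in the first coordinate only.
    Fix [N] and consider the rectangles [Q = I x J] of an antichain [U] with
    [emb Q U < 2^N]; sort them by the residue modulo [N] of the level of [I].
    Within one residue class, a rectangle [P = I' x J'] meeting [Q] with [I']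
    longer than [I] has [I'] at least [2^N] times as long as [I], so [I']
    contains the dyadic ancestor of [I] that is [N] levels up.  If such [P]
    covered half of [Q], then the slices [J'] would cover a subset [V] of [J]
    with [2 |V| >= |J|], and the shadow would contain the product of that
    ancestor and [V].  The [2^N]-fold dilate of [I] lies in the triple of the
    ancestor, and in the product of this triple and [J] the shadow would have
    density at least [1/6], larger than the threshold [1/16]; hence
    [emb Q U >= 2^N], a contradiction ([emb_ge_ancestor]).  So removing from
    [Q] all such [P] leaves a core of at least half its area
    ([area_rect_le_core]).  The cores of one class are pairwise disjoint
    ([trivIset_core]): for intervals [I] of different lengths by construction,
    for equal lengths because two overlapping rectangles with the same first
    side would be nested.  Adding up the [N] classes, the rectangles with
    [emb Q U < 2^N] have total area at most [2 N |sh U|] ([sum_area_emb_lt]).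

    The theorem follows by splitting according to [2^k <= emb Q U < 2^(k+1)]:
    the weight is then at most [q^k] with [q = 2^(-e) < 1], and
    [sum_k q^k (k+1) <= (1-q)^-2]. *)

Section Journe.
Variable R : realType.
Implicit Types (I J : dyadic) (P Q : dyadic_rect) (U : set dyadic_rect).
Local Notation mu := (@lebesgue_measure R).
Local Notation area := (@area R).

(** * Dyadic intervals and rectangles *)

Lemma areaX (A B : set R) : measurable A -> measurable B ->
  area (A `*` B) = (mu A * mu B)%E.
Proof. by move=> mA mB; rewrite /Defs.area product_measure1E. Qed.

Lemma measurable_dyadic I : measurable (dyadic_interval R I).
Proof. exact: measurable_itv. Qed.

Lemma mem_dyadic I x : dyadic_interval R I x <->
  I.1%:~R * 2 ^ I.2 <= x < (I.1%:~R + 1) * 2 ^ I.2.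
Proof. by rewrite /dyadic_interval /= in_itv /= intrD. Qed.

Lemma dyadic_length_gt0 (k : int) : 0 < 2 ^ k :> R.
Proof. by rewrite exprz_gt0. Qed.

Lemma mu_dyadic I : mu (dyadic_interval R I) = (2 ^ I.2)%:E.
Proof.
rewrite /dyadic_interval lebesgue_measure_itv/= lte_fin intrD.
rewrite ltr_pM2r ?dyadic_length_gt0// ltrDl ltr01 -EFinB; congr EFin.
ring.
Qed.

Lemma measurable_rect Q : measurable (rect R Q).
Proof. by apply: measurableX; exact: measurable_dyadic. Qed.

Lemma area_rect Q : area (rect R Q) = (2 ^ Q.1.2 * 2 ^ Q.2.2)%:E.
Proof. by rewrite areaX ?mu_dyadic//; exact: measurable_dyadic. Qed.

Lemma measurable_shadow U : measurable (shadow R U).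
Proof.
rewrite /shadow bigcup_mkcond; apply: countable_bigcupT_measurable => [|Q];
  first exact: countableP.
by case: ifP => // _; exact: measurable_rect.
Qed.

Lemma dyadic_nested I J : (I.2 <= J.2)%R ->
  dyadic_interval R I `&` dyadic_interval R J !=set0 ->
  dyadic_interval R I `<=` dyadic_interval R J.
Proof.
move=> IJ [x [/mem_dyadic/andP[a1 a2] /mem_dyadic/andP[b1 b2]]].
have [n Jn] : exists n : nat, J.2 = I.2 + n%:Z.
  by exists `|J.2 - I.2|%N; rewrite gez0_abs ?subr_ge0// subrKC.
have l0 := dyadic_length_gt0 I.2.
have e2 : (2 ^ J.2 : R) = (2 ^+ n : int)%:~R * 2 ^ I.2.
  by rewrite Jn expfzDr ?pnatr_eq0// mulrC rmorphXn.
have c1 : J.1 * 2 ^+ n <= I.1.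
  rewrite -ltzD1 -(ltr_int R) intrD intrM -(ltr_pM2r l0) -mulrA -e2.
  exact: le_lt_trans a2.
have c2 : I.1 + 1 <= (J.1 + 1) * 2 ^+ n.
  rewrite lezD1 -(ltr_int R) intrM intrD -(ltr_pM2r l0) -mulrA -e2.
  exact: le_lt_trans b2.
move=> y /mem_dyadic/andP[d1 d2]; apply/mem_dyadic/andP; split.
  apply: le_trans d1; rewrite e2 mulrA ler_pM2r//.
  by rewrite -intrM ler_int.
apply: lt_le_trans d2 _; rewrite e2 mulrA ler_pM2r//.
by rewrite -[1]/(1%:~R) -!intrD -intrM ler_int.
Qed.

Lemma dyadic_left_end I : dyadic_interval R I (I.1%:~R * 2 ^ I.2).
Proof.
apply/mem_dyadic; rewrite lexx/= ltr_pM2r ?dyadic_length_gt0//.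
by rewrite ltrDl ltr01.
Qed.

Lemma dilate1_subset I : dilate_interval 1 I `<=` dyadic_interval R I.
Proof.
move=> y; rewrite /dilate_interval /= in_itv /= => /andP[y1 y2].
by apply/mem_dyadic/andP; split; lra.
Qed.

Lemma dyadic_ancestor I (n : nat) :
  exists2 J, J.2 = I.2 + n%:Z & dyadic_interval R I `<=` dyadic_interval R J.
Proof.
set k := I.2 + n%:Z; pose x : R := I.1%:~R * 2 ^ I.2.
exists (Num.floor (x / 2 ^ k), k) => //; apply: dyadic_nested.
  by rewrite /k lerDl.
exists x; split; first exact: dyadic_left_end.
apply/mem_dyadic => /=; have := floor_itv (x / 2 ^ k).
by rewrite intrD ler_pdivlMr ?ltr_pdivrMr ?dyadic_length_gt0.
Qed.

(** * Lower bounds for the embeddedness *)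

(** The average over [A] itself, at every point of [A], beats the threshold. *)
Lemma enl2_dense U (A : set (R * R)) G : axis_rect A -> measurable A ->
  measurable G -> G `<=` A `&` shadow R U -> (area A < 16%:E * area G)%E ->
  A `<=` enl2 U.
Proof.
move=> rA mA mG GA lt16 x Ax; rewrite /enl2 /=.
have [_ [_ [_ /andP[A0 Aoo]]]] := rA.
apply: (@lt_le_trans _ _ ((area A)^-1 * area (shadow R U `&` A))%E); last first.
  apply: ereal_sup_ubound; exists A => //=; congr (_ * _)%E.
  under eq_integral do rewrite ger0_norm//.
  by rewrite integral_indic//; exact: measurable_shadow.
have leG : (area G <= area (shadow R U `&` A))%E.
  apply: le_measure; rewrite ?inE//; last by rewrite setIC.
  by apply: measurableI => //; exact: measurable_shadow.
apply: (@lt_le_trans _ _ ((area A)^-1 * area G)%E); last first.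
  by rewrite lee_wpmul2l// inve_ge0 ltW.
move: A0 Aoo lt16; case: (area A) => [a| |]//; rewrite lte_fin => a0 _.
rewrite inver gt_eqF//.
case: (area G) => [g| |]; last 2 first.
- by move=> _; rewrite gt0_muley ?lte_fin ?invr_gt0// ltry.
- by rewrite [X in (_ < X)%E -> _]gt0_muleNy ?lte_fin.
by rewrite -!EFinM !lte_fin => ag; rewrite mulrC ltr_pdivlMr//; lra.
Qed.

Lemma le_emb (m : R * R) Q U : dil m Q `<=` enl2 U -> 1 <= m.1 -> 1 <= m.2 ->
  ((m.1 * m.2)%:E <= emb R Q U)%E.
Proof. by move=> mQ m1 m2; apply: ereal_sup_ubound; exists m. Qed.

(** The triple [T] of the ancestor interval contains the [2^N]-fold dilate of
    [Q.1], because the centre of [Q.1] lies in the ancestor and the dilate is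
    exactly as long as the ancestor.  The rectangle [T x Q.2] meets the shadow
    in a proportion of at least [1/6]. *)
Lemma emb_ge_ancestor U Q J (N : nat) (V : set R) :
  J.2 = Q.1.2 + N%:Z ->
  dyadic_interval R Q.1 `<=` dyadic_interval R J ->
  measurable V -> V `<=` dyadic_interval R Q.2 ->
  dyadic_interval R J `*` V `<=` shadow R U ->
  ((2 ^ Q.2.2)%:E <= 2%:E * mu V)%E ->
  ((2 ^+ N)%:E <= emb R Q U)%E.
Proof.
move=> eJ QJ mV VQ JV half.
have e2 : (2 ^ J.2 : R) = 2 ^+ N * 2 ^ Q.1.2.
  by rewrite eJ expfzDr ?pnatr_eq0// mulrC.
set a : R := J.1%:~R * 2 ^ J.2; set L : R := 2 ^ J.2.
have L0 : 0 < L by exact: dyadic_length_gt0.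
have l0 := dyadic_length_gt0 Q.2.2.
set T : set R := [set` `[a - L, a + L + L[].
have mT : measurable T by exact: measurable_itv.
have muT : mu T = (3 * L)%:E.
  rewrite /T lebesgue_measure_itv/= lte_fin ifT; last by lra.
  by rewrite -EFinB; congr EFin; ring.
have JT : dyadic_interval R J `<=` T.
  move=> y /mem_dyadic/andP[]; rewrite mulrDl mul1r -/a -/L => y1 y2.
  by rewrite /T /= in_itv /=; apply/andP; split; lra.
have areaT : area (T `*` dyadic_interval R Q.2) = (3 * L * 2 ^ Q.2.2)%:E.
  by rewrite areaX ?muT ?mu_dyadic//; exact: measurable_dyadic.
have enl : T `*` dyadic_interval R Q.2 `<=` enl2 U.
  apply: (@enl2_dense _ _ (dyadic_interval R J `*` V)).
  - exists `[a - L, a + L + L[,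
      `[Q.2.1%:~R * 2 ^ Q.2.2, (Q.2.1 + 1)%:~R * 2 ^ Q.2.2[; split=> //.
    by rewrite areaT lte_fin ltry !mulr_gt0.
  - by apply: measurableX => //; exact: measurable_dyadic.
  - by apply: measurableX => //; exact: measurable_dyadic.
  - by move=> z JVz; split; [case: JVz => /JT ? /VQ|exact: JV].
  - rewrite areaT areaX//; last exact: measurable_dyadic.
    rewrite mu_dyadic -/L.
    have : (0 <= mu V)%E by exact: measure_ge0.
    move: half; case: (mu V) => [v| |]//.
      rewrite -!EFinM !lee_fin lte_fin => half _.
      have : L * 2 ^ Q.2.2 <= L * (2 * v) by rewrite ler_pM2l.
      have : 0 < L * 2 ^ Q.2.2 by rewrite mulr_gt0.
      lra.
    by move=> _ _; rewrite !gt0_muley ?lte_fin// ltry.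
have N1 : 1 <= 2 ^+ N :> R by rewrite exprn_ege1// ler1n.
suff dilT : dil (2 ^+ N : R, 1) Q `<=` enl2 U.
  by have := le_emb (2 ^+ N, 1) Q U dilT N1 (lexx _); rewrite mulr1.
apply: subset_trans enl => -[x y] [/= xd yd]; split => /=; last first.
  exact: dilate1_subset yd.
move: xd; rewrite /dilate_interval /T /= !in_itv /= -e2 -/L.
set c := _ * 2 ^ Q.1.2 => /andP[x1 x2].
have /QJ/mem_dyadic : dyadic_interval R Q.1 c.
  apply/mem_dyadic; rewrite /c; have := dyadic_length_gt0 Q.1.2.
  by move=> ?; rewrite ler_pM2r// ltr_pM2r//; apply/andP; split; lra.
rewrite mulrDl mul1r -/a -/L => /andP[c1 c2].
by apply/andP; split; lra.
Qed.

(** The case [N = 0] of the density argument, with [Q] itself as the part of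
    the shadow.  It keeps the weights of the theorem bounded by one. *)
Lemma emb_ge1 U Q : U Q -> (1 <= emb R Q U)%E.
Proof.
move=> UQ; rewrite -[1%E]/((2 ^+ 0)%:E).
apply: (emb_ge_ancestor U Q Q.1 0 (dyadic_interval R Q.2)) => //.
- by rewrite addr0.
- exact: measurable_dyadic.
- by move=> z Qz; exists Q.
- rewrite mu_dyadic -EFinM lee_fin ler_peMl ?ler1n//.
  exact/ltW/dyadic_length_gt0.
Qed.

(** * Disjoint cores *)

Definition antichain U := forall P Q, U P -> U Q -> rect R P `<=` rect R Q ->
  P = Q.

(** A rectangle that crosses [Q] along its whole first side removes from [Q] a
    product set, so the removed region is recorded as a subset of the second
    side alone.  This makes it comparable with the slice [V] of
    [emb_ge_ancestor]. *)
Definition covered (F : set dyadic_rect) Q : set R :=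
  dyadic_interval R Q.2 `&`
  \bigcup_(P in [set P | F P /\ Q.1.2 < P.1.2 /\
     dyadic_interval R Q.1 `<=` dyadic_interval R P.1]) dyadic_interval R P.2.

Definition core F Q : set (R * R) :=
  dyadic_interval R Q.1 `*` (dyadic_interval R Q.2 `\` covered F Q).

Lemma measurable_covered F Q : measurable (covered F Q).
Proof.
apply: measurableI; first exact: measurable_dyadic.
rewrite bigcup_mkcond; apply: countable_bigcupT_measurable => [|P].
  exact: countableP.
by case: ifP => // _; exact: measurable_dyadic.
Qed.

Lemma measurable_core F Q : measurable (core F Q).
Proof.
apply: measurableX; first exact: measurable_dyadic.
by apply: measurableD; [exact: measurable_dyadic|exact: measurable_covered].
Qed.

Lemma trivIset_core F : antichain F -> trivIset F (core F).
Proof.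
move=> aF P Q FP FQ [[x y] [[/= Px [Py nPy]] [/= Qx [Qy nQy]]]].
have [lt|lt|eq] := ltgtP P.1.2 Q.1.2.
- exfalso; apply: nPy; split => //; exists Q => //; split => //; split => //.
  by apply: dyadic_nested; [exact: ltW|exists x].
- exfalso; apply: nQy; split => //; exists P => //; split => //; split => //.
  by apply: dyadic_nested; [exact: ltW|exists x].
have le1 S T : S.1.2 = T.1.2 -> dyadic_interval R S.1 x ->
    dyadic_interval R T.1 x -> dyadic_interval R S.1 `<=` dyadic_interval R T.1.
  by move=> e Sx Tx; apply: dyadic_nested; [rewrite e|exists x].
have [le2|/ltW le2] := leP P.2.2 Q.2.2.
- apply: aF => // -[u v] [/= Pu Pv]; split => /=; first exact: le1 Pu.
  by apply: dyadic_nested v Pv => //; exists y.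
- apply/esym/aF => // -[u v] [/= Pu Pv]; split => /=.
    by apply: le1 Pu => //.
  by apply: dyadic_nested v Pv => //; exists y.
Qed.

(** If the covered part had half the length of [Q.2], then [emb_ge_ancestor]
    would apply to it: by the gap of [N] levels, each rectangle crossing [Q]
    extends over the [N]-th ancestor of [Q.1]. *)
Lemma area_rect_le_core U F (N : nat) Q : F `<=` U -> F Q ->
  (emb R Q U < (2 ^+ N)%:E)%E ->
  (forall P, F P -> Q.1.2 < P.1.2 -> (Q.1.2 + N%:Z <= P.1.2)%R) ->
  (area (rect R Q) <= 2%:E * area (core F Q))%E.
Proof.
move=> FU FQ embQ gap; set V := covered F Q.
have mV : measurable V := measurable_covered F Q.
have VQ : V `<=` dyadic_interval R Q.2 by move=> y [].
have [J eJ QJ] := dyadic_ancestor Q.1 N.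
have JV : dyadic_interval R J `*` V `<=` shadow R U.
  move=> [x y] [/= Jx [Qy [P [FP [lt QP] Py]]]].
  exists P; first exact: FU.
  split => //=; apply: dyadic_nested x Jx; first by rewrite eJ; exact: gap.
  exists (Q.1.1%:~R * 2 ^ Q.1.2).
  by split; [apply: QJ|apply: QP]; exact: dyadic_left_end.
have /negP : ~ ((2 ^ Q.2.2)%:E <= 2%:E * mu V)%E.
  move=> /(emb_ge_ancestor U Q J N V eJ QJ mV VQ JV) /le_lt_trans/(_ embQ).
  by rewrite ltxx.
rewrite -ltNge => halfV.
have V0 : (0 <= mu V)%E by exact: measure_ge0.
rewrite area_rect areaX; last 2 first.
- exact: measurable_dyadic.
- by apply: measurableD => //; exact: measurable_dyadic.
have Qoo : (mu (dyadic_interval R Q.2) < +oo)%E by rewrite mu_dyadic ltry.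
have Voo : (mu V < +oo)%E.
  apply: le_lt_trans Qoo.
  by apply: le_measure => //; rewrite inE//; exact: measurable_dyadic.
have -> : mu (dyadic_interval R Q.2 `\` V) = ((2 ^ Q.2.2)%:E - mu V)%E.
  rewrite -mu_dyadic -[in RHS](setIidr VQ); apply: measureD => //.
  exact: measurable_dyadic.
rewrite mu_dyadic.
move: halfV V0 Voo; case: (mu V) => [v| |]// + _ _.
rewrite -EFinM -EFinB -!EFinM lte_fin lee_fin => halfV.
have l1 := dyadic_length_gt0 Q.1.2.
have : 2 ^ Q.1.2 * (2 * v) < 2 ^ Q.1.2 * (2 ^ Q.2.2) by rewrite ltr_pM2l.
lra.
Qed.

(** * Counting rectangles of small embeddedness *)

(** The cores are disjoint, lie in the shadow and carry half of each area. *)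
Lemma sum_area_gap U F (N : nat) : antichain U -> finite_set F -> F `<=` U ->
  (forall Q, F Q -> (emb R Q U < (2 ^+ N)%:E)%E) ->
  (forall P Q, F P -> F Q -> Q.1.2 < P.1.2 -> (Q.1.2 + N%:Z <= P.1.2)%R) ->
  (\sum_(Q \in F) area (rect R Q) <= 2%:E * area (shadow R U))%E.
Proof.
move=> aU finF FU embF gap.
apply: (@le_trans _ _ (\sum_(Q \in F) (2%:E * area (core F Q)))%E).
  apply: lee_fsum => // Q FQ; apply: (area_rect_le_core U F N) => //.
    exact: embF.
  by move=> P FP; exact: gap.
rewrite -ge0_mule_fsumr; last by move=> Q; exact: measure_ge0.
rewrite lee_wpmul2l ?lee_fin// -measure_fin_bigcup//; last 2 first.
- by apply: trivIset_core => P Q /FU UP /FU UQ; exact: aU.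
- by move=> Q _; exact: measurable_core.
apply: le_measure; rewrite ?inE; [|exact: measurable_shadow|].
  rewrite bigcup_mkcond; apply: countable_bigcupT_measurable => [|P].
    exact: countableP.
  by case: ifP => // _; exact: measurable_core.
move=> [x y] [Q FQ [Qx [Qy _]]]; exists Q => //; exact: FU.
Qed.

Lemma gap_of_modz (a b : int) (N : nat) : (a %% N%:Z)%Z = (b %% N%:Z)%Z ->
  a < b -> a + N%:Z <= b.
Proof.
rewrite {2 3}(divz_eq a N) {2 3}(divz_eq b N) => ->.
rewrite ltrD2r [X in X <= _]addrAC lerD2r -[X in _ + X <= _]mul1r -mulrDl.
have [->|N0] := posnP N; first by rewrite !mulr0 ltxx.
by rewrite ltr_pM2r// ler_pM2r// lezD1.
Qed.

(** The levels of the first sides in one residue class modulo [N] are separated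
    by gaps of at least [N], and there are [N] classes. *)
Lemma sum_area_emb_lt U F (N : nat) : antichain U -> finite_set F ->
  F `<=` U -> (0 < N)%N ->
  (\sum_(Q \in F) (if (emb R Q U < (2 ^+ N)%:E)%E then area (rect R Q) else 0)
     <= (2 * N%:R)%:E * area (shadow R U))%E.
Proof.
move=> aU finF FU N0.
pose D (r : nat) := [set Q | F Q /\ (emb R Q U < (2 ^+ N)%:E)%E /\
    (Q.1.2 %% N%:Z)%Z = r%:Z].
pose a Q r : \bar R := if Q \in D r then area (rect R Q) else 0%E.
have a0 Q r : (0 <= a Q r)%E by rewrite /a; case: ifP.
rewrite -esum_fset//; last by move=> Q _; case: ifP.
apply: (@le_trans _ _ (\esum_(Q in F) \sum_(r <- iota 0 N) a Q r)).
  apply: le_esum => Q FQ; case: ifPn => embQ; last by rewrite sume_ge0.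
  have N0z : N%:Z != 0 by rewrite eqz_nat -lt0n.
  pose r := `|(Q.1.2 %% N%:Z)%Z|%N.
  have rE : (Q.1.2 %% N%:Z)%Z = r%:Z by rewrite /r gez0_abs ?modz_ge0.
  have rN : r \in iota 0 N.
    rewrite mem_iota add0n /= -ltz_nat -rE.
    exact: (ltz_pmod Q.1.2 (d:=N%:Z) N0).
  have <- : a Q r = area (rect R Q) by rewrite /a ifT// inE.
  by rewrite (big_rem r)//= leeDl// sume_ge0.
rewrite esum_sum//.
have Dle r : (\esum_(Q in F) a Q r <= 2%:E * area (shadow R U))%E.
  have finD : finite_set (D r) by apply: sub_finite_set finF => Q [].
  rewrite -esum_mkcondr (_ : F `&` D r = D r); last first.
    by apply/setIidPr => Q [].
  rewrite esum_fset//; apply: (sum_area_gap U (D r) N) => //.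
  - by move=> Q [/FU].
  - by move=> Q [_ []].
  - move=> P Q [_ [_ eP]] [_ [_ eQ]]; apply: gap_of_modz.
    by rewrite eP eQ.
apply: (@le_trans _ _ (\sum_(r <- iota 0 N) (2%:E * area (shadow R U)))%E).
  by apply: lee_sum => r _; exact: Dle.
rewrite -ge0_sume_distrl; last by move=> r _; rewrite lee_fin.
rewrite sumEFin big_const_seq count_predT size_iota iter_addr_0 mulr_natr.
exact: lexx.
Qed.

(** * Summation of the weights *)

Lemma powR_natX (a e : R) (k : nat) : 0 <= a -> (a ^+ k) `^ e = (a `^ e) ^+ k.
Proof.
by move=> a0; rewrite -!powR_mulrn ?powR_ge0// -!powRrM mulrC.
Qed.

(** The exponent [k] is given by [2^k <= x < 2^(k+1)] when [x] is finite; at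
    [+oo] the weight vanishes.  The bound is a conditional on [x < 2^(k+1)] in
    order to match the sums of [sum_area_emb_lt]. *)
Lemma dyadic_weight (e : R) (x : \bar R) : 0 < e -> (1 <= x)%E ->
  exists k : nat, ((x `^ e)^-1 <=
    if (x < (2 ^+ k.+1)%:E)%E then (((2 `^ e)^-1) ^+ k)%:E else 0)%E.
Proof.
move=> e0; case: x => [m| |]//=; last first.
  by move=> _; exists 0%N; rewrite /= ?poweRyr ?gt_eqF.
rewrite lee_fin => m1; have m0 : 0 <= m by apply: le_trans m1.
have tm := truncn_itv m0; set n := Num.truncn m in tm.
have n0 : (0 < n)%N by rewrite /n truncn_gt0.
have /andP[k1 k2] := trunc_log_bounds (isT : (1 < 2)%N) n0.
set k := trunc_log 2 n in k1 k2; exists k.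
have lo : 2 ^+ k <= m.
  rewrite -natrX; case/andP: tm => + _; apply: le_trans.
  by rewrite ler_nat.
rewrite lte_fin ifT; last first.
  rewrite -natrX; case/andP: tm => _ /lt_le_trans; apply.
  by rewrite ler_nat.
have mgt0 : 0 < m by exact: lt_le_trans m1.
rewrite inver gt_eqF ?powR_gt0// lee_fin exprVn -powR_natX//.
rewrite lef_pV2 ?posrE ?powR_gt0 ?exprn_gt0//.
by rewrite ge0_ler_powR ?nnegrE ?exprn_ge0// ltW.
Qed.

Lemma sum_succ_geometric_le (q : R) (K : nat) : 0 <= q < 1 ->
  \sum_(k <- iota 0 K) q ^+ k * k.+1%:R <= ((1 - q) ^+ 2)^-1.
Proof.
move=> /andP[q0 q1].
have c0 : 0 < (1 - q) ^+ 2 by rewrite exprn_gt0// subr_gt0.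
suff E : (\sum_(k <- iota 0 K) q ^+ k * k.+1%:R) * (1 - q) ^+ 2 =
         1 - q ^+ K * (1 + K%:R * (1 - q)).
  rewrite -[leRHS]mul1r ler_pdivlMr// E gerBl mulr_ge0 ?exprn_ge0//.
  by rewrite addr_ge0// mulr_ge0// subr_ge0 ltW.
elim: K => [|K IH]; first by rewrite big_nil; ring.
rewrite -addn1 iotaD big_cat/= big_seq1 add0n mulrDl IH addn1.
rewrite (exprS q K) -natr1; ring.
Qed.
End Journe.

Theorem lemma30 (R : realType) (e : R) (he : 0 < e) :
  exists C : R, forall U U' : set dyadic_rect,
    (area (shadow R U) < +oo)%E ->
    U' `<=` is_maximal R U ->
    (\esum_(Q in U') ((emb R Q U' `^ e)^-1 * area (rect R Q))
       <= C%:E * area (shadow R U'))%E.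
Proof.
pose q : R := (2 `^ e)^-1.
have q01 : 0 <= q < 1.
  rewrite invr_ge0 powR_ge0 invf_lt1 ?powR_gt0//=.
  have : 1 `^ e < 2 `^ e by rewrite gt0_ltr_powR// ?nnegrE ?ltr1n.
  by rewrite powR1.
have /andP[q0 q1] := q01.
exists (2 * ((1 - q) ^+ 2)^-1) => U U' _ maxU'.
have aU' : antichain R U'.
  move=> P Q U'P U'Q PQ; apply: (@rect_inj R); apply/esym.
  by apply: (maxU' P U'P).2 PQ; case: (maxU' Q U'Q).
apply: ge_ereal_sup => _ [F [finF FU'] <-].
have /choice[k kP] : forall Q, exists k : nat, U' Q ->
    ((emb R Q U' `^ e)^-1 <=
     if (emb R Q U' < (2 ^+ k.+1)%:E)%E then (q ^+ k)%:E else 0)%E.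
  move=> Q; have [U'Q|nU'Q] := pselect (U' Q); last by exists 0%N => /nU'Q.
  by have [k kQ] := dyadic_weight R e _ he (emb_ge1 R U' Q U'Q); exists k.
(* [F] is finite, so finitely many dyadic ranges of [emb] are enough. *)
pose K := (\max_(Q <- finmap.enum_fset (fset_set F)) k Q).+1.
pose a Q j : \bar R := if (emb R Q U' < (2 ^+ j.+1)%:E)%E
  then area (rect R Q) else 0%E.
have a0 Q j : (0 <= a Q j)%E.
  by rewrite /a; case: ifP => // _; exact: measure_ge0.
have qa0 Q j : (0 <= (q ^+ j)%:E * a Q j)%E.
  by rewrite mule_ge0// lee_fin exprn_ge0.
apply: (@le_trans _ _
    (\sum_(Q \in F) \sum_(j <- iota 0 K) ((q ^+ j)%:E * a Q j))%E).
  apply: lee_fsum => // Q FQ.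
  apply: (@le_trans _ _ ((q ^+ k Q)%:E * a Q (k Q))%E).
    rewrite /a; move: (kP Q (FU' Q FQ)); case: ifP => _ kQ.
      by rewrite lee_wpmul2r// area_rect lee_fin mulr_ge0 ?exprz_ge0.
    by rewrite mule0 mule_le0_ge0.
  have kK : k Q \in iota 0 K.
    rewrite mem_iota add0n leq0n/= ltnS.
    by apply: (leq_bigmax_seq (F:=k)) => //; rewrite in_fset_set// inE.
  by rewrite (big_rem (k Q))//= leeDl// sume_ge0.
rewrite -esum_fset//; last by move=> Q _; rewrite sume_ge0.
rewrite esum_sum//.
apply: (@le_trans _ _ (\sum_(j <- iota 0 K)
   ((q ^+ j * (2 * j.+1%:R))%:E * area (shadow R U')))%E).
  apply: lee_sum => j _; rewrite esum_fset//.
  rewrite -ge0_mule_fsumr// EFinM -muleA lee_wpmul2l ?lee_fin ?exprn_ge0//.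
  exact: (sum_area_emb_lt R U' F j.+1).
rewrite -ge0_sume_distrl; last first.
  by move=> j _; rewrite lee_fin !mulr_ge0// exprn_ge0.
rewrite sumEFin lee_wpmul2r ?measure_ge0// lee_fin.
under eq_bigr do rewrite mulrCA.
by rewrite -mulr_sumr ler_pM2l// sum_succ_geometric_le.
Qed.
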